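(* Let $F$ be a field and let $\theta$ and $\tilde{\theta}$ be two equivalent non-trivial iterative derivations on $F$. Let $\lambda:F[[T]]\to F[[T]]$ be a continuous isomorphism of $F$-algebras such that $\tilde{\theta}=\lambda\circ\theta$, and let $P_\lambda(T):=\lambda(T)\in F[[T]]$. (1) For an ID-module $(M,\theta_M)$ over $(F,\theta)$, the $F$-vector space $M$ together with the map $$\tilde{\theta}_M:=(\mathrm{id}_M\otimes\lambda)\circ\theta_M:\ M\longrightarrow M[[T]]=M\otimes_F F[[T]],\qquad m\longmapsto \sum_{k=0}^\infty \theta_M^{(k)}(m)P_\lambda(T)^k,$$ is an ID-module $(M,\tilde{\theta}_M)$ over $(F,\tilde{\theta})$. (2) The assignment $(M,\theta_M)\mapsto(M,\tilde{\theta}_M)$ of part (1) induces (acting as the identity on the underlying $F$-linear maps) an equivalence of categories between the category of ID-modules over $(F,\theta)$ and the category of ID-modules over $(F,\tilde{\theta})$.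
   Context: An iterative derivation on a ring $R$ is a ring homomorphism $\theta:R\to R[[T]]$, $\theta(r)=\sum_{i\ge 0}\theta^{(i)}(r)T^i$, with $\theta^{(0)}=\mathrm{id}_R$ and $\theta^{(i)}\circ\theta^{(j)}=\binom{i+j}{i}\theta^{(i+j)}$ for all $i,j\ge 0$. It is trivial if $\theta(r)=r$ for all $r\in R$, and non-trivial otherwise. Power series rings carry the $\mathfrak{m}$-adic topology, $\mathfrak{m}$ being the ideal generated by the variables. Two iterative derivations $\theta,\tilde{\theta}$ on a field $F$ are equivalent if there exists a continuous isomorphism of $F$-algebras $\lambda:F[[T]]\to F[[T]]$ such that $\tilde{\theta}=\lambda\circ\theta$. An ID-module $(M,\theta_M)$ over $(F,\theta)$ is a finitely generated $F$-module (i.e. finite-dimensional vector space) $M$ with an additive map $\theta_M:M\to M[[T]]$, $\theta_M(m)=\sum_{i\ge 0}\theta_M^{(i)}(m)T^i$, such that $\theta_M(rm)=\theta(r)\theta_M(m)$ for $r\in F$, $m\in M$, $\theta_M^{(0)}=\mathrm{id}_M$, and $\theta_M^{(i)}\circ\theta_M^{(j)}=\binom{i+j}{i}\theta_M^{(i+j)}$ for all $i,j\ge 0$. An ID-homomorphism $\varphi:(M,\theta_M)\to(N,\theta_N)$ is an $F$-linear map $\varphi:M\to N$ with $\varphi[[T]]\circ\theta_M=\theta_N\circ\varphi$, where $\varphi[[T]]:M[[T]]\to N[[T]]$ applies $\varphi$ coefficientwise. The category of ID-modules has ID-homomorphisms as morphisms. *)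

(* Defs.v *)
From HB Require Import structures.
From mathcomp Require Import all_boot all_order all_algebra.
From mathcomp Require Import boolp classical_sets filter topology.

Set Implicit Arguments.
Unset Strict Implicit.
Unset Printing Implicit Defensive.
Import GRing.Theory.

Local Open Scope classical_set_scope.
Local Open Scope ring_scope.

Record powser (V : Type) := PowSer { pscoef : nat -> V }.

Lemma pscoefK V : cancel (@pscoef V) (@PowSer V).
Proof. by case. Qed.

Lemma psP V (a b : powser V) : pscoef a =1 pscoef b -> a = b.
Proof. by case: a b => [a] [b] /= /funext ->. Qed.

HB.instance Definition _ (V : choiceType) :=
  Choice.copy (powser V) (can_type (@pscoefK V)).

Section PowserZmodule.
Variable V : zmodType.

Definition ps0 : powser V := PowSer (fun=> 0).
Definition psadd (a b : powser V) := PowSer (fun n => pscoef a n + pscoef b n).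
Definition psopp (a : powser V) := PowSer (fun n => - pscoef a n).

Fact psaddA : associative psadd.
Proof. by move=> a b c; apply: psP => n; rewrite /= addrA. Qed.
Fact psaddC : commutative psadd.
Proof. by move=> a b; apply: psP => n; rewrite /= addrC. Qed.
Fact psadd0 : left_id ps0 psadd.
Proof. by move=> a; apply: psP => n; rewrite /= add0r. Qed.
Fact psaddN : left_inverse ps0 psopp psadd.
Proof. by move=> a; apply: psP => n; rewrite /= addNr. Qed.

HB.instance Definition _ :=
  GRing.isZmodule.Build (powser V) psaddA psaddC psadd0 psaddN.

Definition psC (v : V) : powser V := PowSer (fun n => if n == 0%N then v else 0).

Lemma pscoefD (a b : powser V) n : pscoef (a + b) n = pscoef a n + pscoef b n.
Proof. by []. Qed.

Lemma pscoef_sum I (r : seq I) (P : pred I) (f : I -> powser V) n :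
  pscoef (\sum_(i <- r | P i) f i) n = \sum_(i <- r | P i) pscoef (f i) n.
Proof. exact: (big_morph (fun a : powser V => pscoef a n)). Qed.

End PowserZmodule.

(* [M[[T]]] for an [R]-module [M]: a copy of [powser M] whose module structure
   is the one over [powser R]; [powser R] itself is kept as an [R]-algebra. *)
Definition mpowser (M : Type) : Type := powser M.

HB.instance Definition _ (M : zmodType) := GRing.Zmodule.on (mpowser M).

Section Convolution.
Variables (R : comNzRingType) (M : lmodType R).

Definition psconv (a : powser R) (u : powser M) : powser M :=
  PowSer (fun n => \sum_(i < n.+1) pscoef a i *: pscoef u (n - i)%N).

Lemma pscoef_conv a u n :
  pscoef (psconv a u) n = \sum_(i < n.+1) pscoef a i *: pscoef u (n - i)%N.
Proof. by []. Qed.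

Lemma psconv_rev a u n :
  pscoef (psconv a u) n = \sum_(i < n.+1) pscoef a (n - i)%N *: pscoef u i.
Proof.
rewrite /= (reindex_inj rev_ord_inj) /=.
by apply: eq_bigr => j _; rewrite (sub_ordK j).
Qed.

Lemma psconv1 u : psconv (psC 1) u = u.
Proof.
apply: psP => n /=; rewrite big_ord_recl subn0 /= scale1r big1 ?addr0 // => i _.
by rewrite /= scale0r.
Qed.

Lemma psconvDr a : {morph psconv a : u v / u + v}.
Proof.
move=> u v; apply: psP => n /=; rewrite -big_split /=.
by apply: eq_bigr => i _; rewrite scalerDr.
Qed.

Lemma psconvDl u : {morph psconv^~ u : a b / a + b}.
Proof.
move=> a b; apply: psP => n /=; rewrite -big_split /=.
by apply: eq_bigr => i _; rewrite scalerDl.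
Qed.

Lemma psconvC a m : pscoef (psconv a (psC m)) =1 fun n => pscoef a n *: m.
Proof.
move=> n; rewrite psconv_rev big_ord_recl subn0 /= big1 ?addr0 // => i _.
by rewrite /= scaler0.
Qed.

End Convolution.

Definition psmul (R : comNzRingType) : powser R -> powser R -> powser R :=
  @psconv R R^o.

Lemma psconvA (R : comNzRingType) (M : lmodType R) (a b : powser R) (u : powser M) :
  psconv a (psconv b u) = psconv (psmul a b) u.
Proof.
apply: psP => n; rewrite [RHS]psconv_rev pscoef_conv.
pose F j k := pscoef a j *: (pscoef b (n - j - k)%N *: pscoef u k).
transitivity (\sum_(j < n.+1) \sum_(k < n.+1 | (k <= n - j)%N) F j k).
  apply: eq_bigr => j _; rewrite psconv_rev scaler_sumr.
  by rewrite (big_ord_narrow_leq (leq_subr _ _)).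
rewrite (exchange_big_dep predT) //=; apply: eq_bigr => k _.
transitivity (\sum_(j < n.+1 | (j <= n - k)%N) F j k).
  apply: eq_bigl => j; rewrite -ltnS -(ltnS j) -!subSn ?leq_ord //.
  by rewrite -subn_gt0 -(subn_gt0 j) -!subnDA addnC.
rewrite (big_ord_narrow_leq (leq_subr _ _)) scaler_suml.
by apply: eq_bigr => j _; rewrite /F -!subnDA addnC scalerA.
Qed.

Section PowserRing.
Variable R : comNzRingType.
Implicit Types a b c : powser R.

Fact psmulA : associative (@psmul R).
Proof. by move=> a b c; exact: (@psconvA R R^o). Qed.
Fact psmulC : commutative (@psmul R).
Proof.
move=> a b; apply: psP => n; rewrite [LHS](@psconv_rev R R^o) /=.
by apply: eq_bigr => i _; exact: mulrC.
Qed.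
Fact psmul1 : left_id (psC 1) (@psmul R).
Proof. exact: (@psconv1 R R^o). Qed.
Fact psmulDl : left_distributive (@psmul R) +%R.
Proof. by move=> a b c; exact: (@psconvDl R R^o). Qed.
Fact ps1_neq0 : psC 1 != 0 :> powser R.
Proof.
by apply/eqP => /(congr1 (fun a => pscoef a 0%N)) /= /eqP; rewrite oner_eq0.
Qed.

HB.instance Definition _ := GRing.Zmodule_isComNzRing.Build (powser R)
  psmulA psmulC psmul1 psmulDl ps1_neq0.

Lemma pscoefM a b n :
  pscoef (a * b) n = \sum_(i < n.+1) pscoef a i * pscoef b (n - i)%N.
Proof. by []. Qed.

Definition psscale (r : R) a : powser R := PowSer (fun n => r * pscoef a n).

Fact psscaleA r s a : psscale r (psscale s a) = psscale (r * s) a.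
Proof. by apply: psP => n; rewrite /= mulrA. Qed.
Fact psscale1 : left_id 1 psscale.
Proof. by move=> a; apply: psP => n; rewrite /= mul1r. Qed.
Fact psscaleDr : right_distributive psscale +%R.
Proof. by move=> r a b; apply: psP => n; rewrite /= mulrDr. Qed.
Fact psscaleDl a : {morph psscale^~ a : r s / r + s}.
Proof. by move=> r s; apply: psP => n; rewrite /= mulrDl. Qed.

HB.instance Definition _ := GRing.Zmodule_isLmodule.Build R (powser R)
  psscaleA psscale1 psscaleDr psscaleDl.

Fact psscaleAl (r : R) a b : r *: (a * b) = (r *: a) * b.
Proof.
apply: psP => n; rewrite /= mulr_sumr.
by apply: eq_bigr => i _; exact: mulrA.
Qed.

HB.instance Definition _ := GRing.Lmodule_isLalgebra.Build R (powser R) psscaleAl.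
HB.instance Definition _ := GRing.Lalgebra_isComAlgebra.Build R (powser R).

Definition psX : powser R := PowSer (fun n => (n == 1%N)%:R).

End PowserRing.

Notation "''T'" := (@psX _) : ring_scope.

HB.instance Definition _ (R : comNzRingType) (M : lmodType R) :=
  GRing.Zmodule_isLmodule.Build (powser R) (mpowser M)
    (@psconvA R M) (@psconv1 R M) (@psconvDr R M) (@psconvDl R M).

(* The ideal m is generated by T, so m^n V = T^n V. *)
Definition adic_nbhs (R : comNzRingType) (V : lmodType (powser R)) (v : V) :
    set_system V :=
  filter_from [set: nat] (fun n => [set v + 'T ^+ n *: w | w in [set: V]]).

Section AdicNbhs.
Variables (R : comNzRingType) (V : lmodType (powser R)).

Lemma adic_nbhs_filter (v : V) : ProperFilter (adic_nbhs v).
Proof.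
apply: filter_from_proper; last first.
  by move=> n _; exists (v + 'T ^+ n *: 0), 0.
apply: filter_from_filter; first by exists 0%N.
move=> i j _ _; exists (i + j)%N => // _ [w _ <-]; split.
  by exists ('T ^+ j *: w) => //; rewrite scalerA -exprD.
by exists ('T ^+ i *: w) => //; rewrite scalerA -exprD addnC.
Qed.

Lemma adic_nbhs_singleton (v : V) (A : set V) : adic_nbhs v A -> A v.
Proof. by case=> n _; apply; exists 0 => //; rewrite scaler0 addr0. Qed.

Lemma adic_nbhs_nbhs (v : V) (A : set V) :
  adic_nbhs v A -> adic_nbhs v (fun w => adic_nbhs w A).
Proof.
case=> n _ nA; exists n => // _ [w _ <-]; exists n => // _ [w' _ <-].
by apply: nA; exists (w + w') => //; rewrite scalerDr addrA.
Qed.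

End AdicNbhs.

HB.instance Definition _ (R : comNzRingType) :=
  hasNbhs.Build (powser R) (@adic_nbhs R (powser R)^o).
HB.instance Definition _ (R : comNzRingType) :=
  Nbhs_isNbhsTopological.Build (powser R)
    (@adic_nbhs_filter R (powser R)^o) (@adic_nbhs_singleton R (powser R)^o)
    (@adic_nbhs_nbhs R (powser R)^o).

HB.instance Definition _ (R : comNzRingType) (M : lmodType R) :=
  hasNbhs.Build (mpowser M) (@adic_nbhs R (mpowser M)).
HB.instance Definition _ (R : comNzRingType) (M : lmodType R) :=
  Nbhs_isNbhsTopological.Build (mpowser M)
    (@adic_nbhs_filter R (mpowser M)) (@adic_nbhs_singleton R (mpowser M))
    (@adic_nbhs_nbhs R (mpowser M)).

Record iterder (R : comNzRingType) := IterDer {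
  iterder_map :> {rmorphism R -> powser R};
  iterder0 : forall r, pscoef (iterder_map r) 0%N = r;
  iterder_iter : forall i j r,
    pscoef (iterder_map (pscoef (iterder_map r) j)) i =
    pscoef (iterder_map r) (i + j)%N *+ 'C(i + j, i)
}.

Definition iterder_trivial (R : comNzRingType) (theta : iterder R) :=
  forall r, theta r = psC r.

Definition cont_alg_iso (F : fieldType)
    (lambda : {lrmorphism powser F -> powser F}) :=
  bijective lambda /\ continuous lambda.

Definition iterder_equiv (F : fieldType) (theta theta' : iterder F) :=
  exists lambda : {lrmorphism powser F -> powser F},
    cont_alg_iso lambda /\ theta' =1 lambda \o theta.

Section IDModules.
Variables (F : fieldType) (theta : iterder F).

Record is_idmodule (M : vectType F) (thetaM : M -> mpowser M) : Prop := {
  idmoduleD : {morph thetaM : x y / x + y};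
  idmoduleZ : forall (r : F) (m : M), thetaM (r *: m) = theta r *: thetaM m;
  idmodule0 : forall m, pscoef (thetaM m) 0%N = m;
  idmodule_iter : forall i j m,
    pscoef (thetaM (pscoef (thetaM m) j)) i =
    pscoef (thetaM m) (i + j)%N *+ 'C(i + j, i)
}.

Record idmodule := IDModule {
  idmodule_sort :> vectType F;
  idmodule_map : idmodule_sort -> mpowser idmodule_sort;
  idmodule_axiom : is_idmodule idmodule_map
}.

Arguments idmodule_map : clear implicits.

Definition mpsmap (M N : Type) (phi : M -> N) (u : mpowser M) : mpowser N :=
  PowSer (phi \o pscoef u).

Definition is_idhom (M N : idmodule) (phi : 'Hom(M, N)) : Prop :=
  mpsmap phi \o idmodule_map M =1 idmodule_map N \o phi.

Record idhom (M N : idmodule) := IDHom {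
  idhom_lfun :> 'Hom(M, N);
  idhom_axiom : is_idhom idhom_lfun
}.

Lemma idhom_inj (M N : idmodule) (f g : idhom M N) :
  idhom_lfun f = idhom_lfun g -> f = g.
Proof.
case: f g => [f hf] [g hg] /= fg; case: _ / fg hg => hg.
by congr IDHom; exact: Prop_irrelevance.
Qed.

Lemma is_idhom_id (M : idmodule) : @is_idhom M M \1%VF.
Proof.
by move=> m; apply: psP => n; rewrite /= !id_lfunE.
Qed.

Lemma is_idhom_comp (M N P : idmodule) (g : idhom N P) (f : idhom M N) :
  @is_idhom M P (g \o f)%VF.
Proof.
move=> m; rewrite /= comp_lfunE.
transitivity (mpsmap g (mpsmap f (idmodule_map M m))).
  by apply: psP => n; rewrite /= comp_lfunE.
by have /= -> := idhom_axiom f m; exact: (idhom_axiom g (f m)).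
Qed.

Definition idhom_id M : idhom M M := IDHom (@is_idhom_id M).
Definition idhom_comp M N P (g : idhom N P) (f : idhom M N) : idhom M P :=
  IDHom (is_idhom_comp g f).

End IDModules.

Arguments idmodule_map {F theta}.

Record category := Category {
  cat_ob :> Type;
  cat_hom : cat_ob -> cat_ob -> Type;
  cat_id : forall a, cat_hom a a;
  cat_comp : forall a b c, cat_hom b c -> cat_hom a b -> cat_hom a c;
  cat_id_l : forall a b (f : cat_hom a b), cat_comp (cat_id b) f = f;
  cat_id_r : forall a b (f : cat_hom a b), cat_comp f (cat_id a) = f;
  cat_compA : forall a b c d (h : cat_hom c d) (g : cat_hom b c)
    (f : cat_hom a b), cat_comp h (cat_comp g f) = cat_comp (cat_comp h g) f
}.

Record cat_functor (C D : category) := CatFunctor {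
  fun_ob :> C -> D;
  fun_hom : forall a b, cat_hom a b -> cat_hom (fun_ob a) (fun_ob b);
  fun_hom_id : forall a, fun_hom (cat_id a) = cat_id (fun_ob a);
  fun_hom_comp : forall a b c (g : cat_hom b c) (f : cat_hom a b),
    fun_hom (cat_comp g f) = cat_comp (fun_hom g) (fun_hom f)
}.

Definition functor_id (C : category) : cat_functor C C :=
  @CatFunctor C C id (fun a b f => f) (fun=> erefl) (fun _ _ _ _ _ => erefl).

Section FunctorComp.
Variables (C D E : category) (G : cat_functor D E) (H : cat_functor C D).

Definition functor_comp_hom a b (f : cat_hom a b) := fun_hom G (fun_hom H f).

Lemma functor_comp_id a : functor_comp_hom (cat_id a) = cat_id (G (H a)).
Proof. by rewrite /functor_comp_hom !fun_hom_id. Qed.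

Lemma functor_comp_comp a b c (g : cat_hom b c) (f : cat_hom a b) :
  functor_comp_hom (cat_comp g f) =
  cat_comp (functor_comp_hom g) (functor_comp_hom f).
Proof. by rewrite /functor_comp_hom !fun_hom_comp. Qed.

Definition functor_comp : cat_functor C E :=
  @CatFunctor C E (G \o H) functor_comp_hom functor_comp_id functor_comp_comp.

End FunctorComp.

Definition cat_iso (C : category) (a b : C) (f : cat_hom a b) :=
  exists g : cat_hom b a, cat_comp g f = cat_id a /\ cat_comp f g = cat_id b.

Definition nat_iso (C D : category) (G H : cat_functor C D) :=
  exists eta : forall a : C, cat_hom (G a) (H a),
    (forall a, cat_iso (eta a)) /\
    (forall a b (f : cat_hom a b),
       cat_comp (fun_hom H f) (eta a) = cat_comp (eta b) (fun_hom G f)).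

Definition cat_equivalence (C D : category) (G : cat_functor C D) :=
  exists H : cat_functor D C,
    nat_iso (functor_comp H G) (functor_id C) /\
    nat_iso (functor_comp G H) (functor_id D).

Section IDCategory.
Variables (F : fieldType) (theta : iterder F).

Lemma idhom_id_l (M N : idmodule theta) (f : idhom M N) :
  idhom_comp (idhom_id N) f = f.
Proof. by apply: idhom_inj; rewrite /= comp_lfun1l. Qed.

Lemma idhom_id_r (M N : idmodule theta) (f : idhom M N) :
  idhom_comp f (idhom_id M) = f.
Proof. by apply: idhom_inj; rewrite /= comp_lfun1r. Qed.

Lemma idhom_compA (M N P Q : idmodule theta) (h : idhom P Q) (g : idhom N P)
    (f : idhom M N) :
  idhom_comp h (idhom_comp g f) = idhom_comp (idhom_comp h g) f.
Proof. by apply: idhom_inj; rewrite /= comp_lfunA. Qed.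

Definition IDMod : category :=
  @Category (idmodule theta) (@idhom F theta) (@idhom_id F theta)
    (@idhom_comp F theta) idhom_id_l idhom_id_r idhom_compA.

End IDCategory.

Section Twist.
Variable F : fieldType.

Definition ps_tensor (M : lmodType F) (m : M) (f : powser F) : mpowser M :=
  f *: (psC m : mpowser M).

Lemma pscoef_tensor (M : lmodType F) (m : M) (f : powser F) n :
  pscoef (ps_tensor m f) n = pscoef f n *: m.
Proof. exact: psconvC. Qed.

(* [id_M (x) lambda] on [M[[T]] = M (x)_F F[[T]]], computed on the basis
   [vbasis fullv] of [M]; by [id_tensorE] and [id_tensor_id] it does not depend
   on that basis. *)
Definition id_tensor (M : vectType F) (lambda : powser F -> powser F)
    (u : mpowser M) : mpowser M :=
  \sum_(i < \dim {:M})
    ps_tensor (vbasis {:M})`_i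
      (lambda (PowSer (fun n => coord (vbasis {:M}) i (pscoef u n)))).

Lemma id_tensorE (M : vectType F) (lambda : {linear powser F -> powser F})
    (m : M) (f : powser F) :
  id_tensor lambda (ps_tensor m f) = ps_tensor m (lambda f).
Proof.
apply: psP => n; rewrite /id_tensor pscoef_sum pscoef_tensor.
rewrite [in RHS](coord_vbasis (memvf m)) scaler_sumr.
apply: eq_bigr => i _; rewrite pscoef_tensor scalerA.
set g := PowSer _; suff -> : g = coord (vbasis {:M}) i m *: f.
  by rewrite linearZ /= mulrC.
apply: psP => k; transitivity (coord (vbasis {:M}) i (pscoef (ps_tensor m f) k)).
  by [].
by rewrite pscoef_tensor linearZ /= mulrC.
Qed.

Lemma id_tensor_id (M : vectType F) (u : mpowser M) : id_tensor id u = u.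
Proof.
apply: psP => n; rewrite /id_tensor pscoef_sum.
rewrite [RHS](coord_vbasis (memvf _)).
by apply: eq_bigr => i _; rewrite pscoef_tensor.
Qed.

Definition twist (M : vectType F) (lambda : powser F -> powser F)
    (thetaM : M -> mpowser M) : M -> mpowser M :=
  id_tensor lambda \o thetaM.

Variables (theta theta' : iterder F) (lambda : powser F -> powser F).
Hypothesis twist_ob_axiom :
  forall M : idmodule theta, is_idmodule theta' (twist lambda (idmodule_map M)).

Definition twist_ob (M : idmodule theta) : idmodule theta' :=
  IDModule (twist_ob_axiom M).

Hypothesis twist_hom_axiom : forall (M N : idmodule theta) (f : idhom M N),
  @is_idhom F theta' (twist_ob M) (twist_ob N) f.

Definition twist_hom (M N : idmodule theta) (f : idhom M N) :
  idhom (twist_ob M) (twist_ob N) := IDHom (twist_hom_axiom f).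

Lemma twist_hom_id (M : idmodule theta) :
  twist_hom (idhom_id M) = idhom_id (twist_ob M).
Proof. exact: idhom_inj. Qed.

Lemma twist_hom_comp (M N P : idmodule theta) (g : idhom N P) (f : idhom M N) :
  twist_hom (idhom_comp g f) = idhom_comp (twist_hom g) (twist_hom f).
Proof. exact: idhom_inj. Qed.

Definition twist_functor : cat_functor (IDMod theta) (IDMod theta') :=
  @CatFunctor (IDMod theta) (IDMod theta') twist_ob twist_hom
    twist_hom_id twist_hom_comp.

End Twist.

(* Main.v *)
Require Import Defs.
From HB Require Import structures.
From mathcomp Require Import all_boot all_order all_algebra.
From mathcomp Require Import zify.
From mathcomp Require Import boolp classical_sets filter topology.

Set Implicit Arguments.
Unset Strict Implicit.
Unset Printing Implicit Defensive.
Import GRing.Theory.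

Local Open Scope classical_set_scope.
Local Open Scope ring_scope.

(** Write P for [lambda 'T].  The constant term of P vanishes and [lambda] is the
substitution T := P, on F[[T]] and, coefficientwise, on M[[T]]
([pscoef_id_tensor]).  So the twist of theta_M is m |-> sum_k theta_M^(k)(m) P^k;
it is semilinear for theta' because [lambda] is multiplicative.  The content
of the theorem is that it is again iterative.

The difficulty is that the coefficients of P need not be constants for theta'.  Let
theta'_U denote theta' with values in F[[U]].  Using that theta_M is iterative,
the twist applied twice is
  m |-> sum_n theta_M^(n)(m) A^n,  A = P(U) + theta'_U(P)(T) in F[[T,U]]
([pscoef_twist_twist]), whereas iterativity asks for
  m |-> sum_n theta_M^(n)(m) B^n,  B = P(T+U)
([pscoef_twist_shift]).  It is therefore enough that A = B, a statement in which
no module occurs.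

It is obtained from the module F itself ([iter_twist_paramE]).  There the twist
is theta', which is iterative by assumption, so
sum_n theta^(n)(r) (A^n - B^n) = 0 for all r.  Let q > 0 be least with
theta^(q) <> 0; here non-triviality enters.  The identities
theta^(i) theta^(q-i) = 'C(q, i) theta^(q) show that 'C(q, i) = 0 in F for
0 < i < q, whence theta^(n) = 0 unless q divides n ([iterder_order]).  All terms
with n <> q are thus multiples of A^q - B^q by a series without constant term,
and comparing lowest terms gives A^q = B^q ([iter_twist_paramX_order]).  As the
middle binomial coefficients vanish, (B - A)^q = B^q - A^q = 0, and F[[T,U]] is a
domain, so A = B ([exprn_inj_bin]).

For the equivalence of categories, the inverse of [lambda] is again an algebra
morphism and theta = lambda^-1 o theta', so the same construction gives a functor
in the other direction.  Twisting by [lambda] and then by its inverse restores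
theta_M ([id_tensorK]), so the identity maps of the underlying vector spaces are
the components of the natural isomorphisms. *)

(** * Divisibility by powers of T *)

Lemma pscoefXn_scale (R : comNzRingType) (M : lmodType R) n (u : mpowser M) k :
  pscoef ('T ^+ n *: u) k = if (k < n)%N then 0 else pscoef u (k - n).
Proof.
elim: n k => [|n IHn] k; first by rewrite expr0 scale1r subn0.
rewrite exprS -scalerA.
have -> (v : mpowser M) :
    pscoef ('T *: v) k = if k is k'.+1 then pscoef v k' else 0.
  rewrite [LHS]pscoef_conv; case: k => [|k]; first by rewrite big_ord1 scale0r.
  rewrite big_ord_recl scale0r add0r big_ord_recl scale1r subSS subn0.
  by rewrite big1 ?addr0 // => i _; rewrite scale0r.
by case: k => [|k] //; rewrite IHn ltnS subSS.
Qed.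

Lemma pscoefXnM (R : comNzRingType) n (a : powser R) k :
  pscoef ('T ^+ n * a) k = if (k < n)%N then 0 else pscoef a (k - n).
Proof. exact: (@pscoefXn_scale R R^o). Qed.

Lemma pscoef0M (R : comNzRingType) (a b : powser R) :
  pscoef (a * b) 0 = pscoef a 0 * pscoef b 0.
Proof. by rewrite pscoefM big_ord1. Qed.

Lemma ps_divXn (R : comNzRingType) (M : lmodType R) n (u : mpowser M) :
  (forall k, (k < n)%N -> pscoef u k = 0) ->
  u = 'T ^+ n *: (PowSer (fun k => pscoef u (n + k)) : mpowser M).
Proof.
move=> u0; apply: psP => k; rewrite pscoefXn_scale.
by case: ltnP => [/u0 //|nk]; rewrite /= subnKC.
Qed.

(** * Algebra endomorphisms of F[[T]] are substitutions *)

Section Substitution.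
Variables (F : fieldType) (lambda : {lrmorphism powser F -> powser F}).

(** If c, the constant term of [lambda 'T], were nonzero, then 1 - T/c, a unit
of F[[T]], would be mapped to a series with zero constant term. *)
Lemma ps_lrmorphT0 : pscoef (lambda 'T) 0 = 0.
Proof.
set c := pscoef _ 0; apply/eqP/negPn/negP => c0.
pose G : powser F := PowSer (fun n => c^-1 ^+ n).
have invG : (1 - c^-1 *: 'T) * G = 1.
  apply: psP => n; rewrite mulrBl mul1r -scalerAl pscoefD.
  have -> : pscoef (- (c^-1 *: ('T * G))) n = - (c^-1 * pscoef ('T * G) n) by [].
  rewrite -[X in X * G]expr1 pscoefXnM.
  case: n => [|n] /=; first by rewrite mulr0 subr0.
  by rewrite subSS subn0 -exprS subrr.
have /(congr1 (@pscoef F ^~ 0%N)) := congr1 lambda invG.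
have lambdaB : lambda (1 - c^-1 *: 'T) = 1 - c^-1 *: lambda 'T.
  by rewrite linearB rmorph1 linearZ.
have lambdaM a b : lambda (a * b) = lambda a * lambda b by exact: rmorphM.
rewrite lambdaM lambdaB rmorph1 pscoef0M pscoefD.
have -> : pscoef (- (c^-1 *: lambda 'T)) 0 = - (c^-1 * c) by [].
by rewrite mulVf // subrr mul0r => /esym/eqP; rewrite (negPf (oner_neq0 F)).
Qed.

Lemma pscoef_lrmorphTX k n : (n < k)%N -> pscoef (lambda 'T ^+ k) n = 0.
Proof.
move=> nk; pose Q : powser F := PowSer (fun i => pscoef (lambda 'T) (1 + i)).
have -> : lambda 'T = 'T ^+ 1 * Q.
  by apply: (@ps_divXn F F^o 1) => -[] // _; exact: ps_lrmorphT0.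
by rewrite expr1 exprMn pscoefXnM nk.
Qed.

(** Modulo T^N, f is a polynomial g, and [lambda] maps T^N to a multiple of
T^N.  Any truncation N > n is allowed, so that coefficients of different degrees
can be expanded over one common range. *)
Lemma pscoef_lrmorph (f : powser F) N n : (n < N)%N ->
  pscoef (lambda f) n = \sum_(k < N) pscoef f k * pscoef (lambda 'T ^+ k) n.
Proof.
move=> nN; pose g := \sum_(k < N) pscoef f k *: 'T ^+ k : powser F.
pose h : powser F := PowSer (fun k => pscoef (f - g) (N + k)).
have fg : f - g = 'T ^+ N * h.
  apply: (@ps_divXn F F^o N) => k kN; rewrite pscoefD.
  have -> : pscoef (- g) k = - pscoef g k by [].
  rewrite /g pscoef_sum (bigD1 (Ordinal kN)) //= big1 => [|i /negPf ik].
    by rewrite -[_ ^+ _]mulr1 pscoefXnM ltnn subnn mulr1 addr0 subrr.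
  rewrite -['T ^+ i]mulr1 pscoefXnM; case: ltnP => [_|ki]; rewrite ?mulr0 //.
  rewrite /= subn_eq0 leqNgt ltn_neqAle ki andbT.
  by move: ik; rewrite -val_eqE /= => ->; rewrite mulr0.
have -> : lambda f = lambda 'T ^+ N * lambda h + lambda g.
  by rewrite -rmorphXn -rmorphM -rmorphD -fg subrK.
rewrite pscoefD pscoefM big1 ?add0r => [|i _]; last first.
  by rewrite pscoef_lrmorphTX ?mul0r // (leq_ltn_trans _ nN) // leq_ord.
rewrite linear_sum pscoef_sum; apply: eq_bigr => k _.
by rewrite linearZ rmorphXn.
Qed.

Lemma pscoef_id_tensor (M : vectType F) (u : mpowser M) N n : (n < N)%N ->
  pscoef (id_tensor lambda u) n =
  \sum_(k < N) pscoef (lambda 'T ^+ k) n *: pscoef u k.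
Proof.
move=> nN; rewrite /id_tensor pscoef_sum.
under eq_bigr => i _ do
  rewrite pscoef_tensor (pscoef_lrmorph _ nN) scaler_suml.
rewrite exchange_big /=; apply: eq_bigr => k _.
rewrite [in RHS](coord_vbasis (memvf (pscoef u k))) scaler_sumr.
by apply: eq_bigr => i _; rewrite scalerA mulrC.
Qed.

Lemma id_tensorD (M : vectType F) : {morph @id_tensor F M lambda : u v / u + v}.
Proof.
move=> u v; apply: psP => n; rewrite pscoefD !(pscoef_id_tensor _ (ltnSn n)).
by rewrite -big_split; apply: eq_bigr => k _; rewrite pscoefD scalerDr.
Qed.

Lemma id_tensorZ (M : vectType F) (a : powser F) (u : mpowser M) :
  id_tensor lambda (a *: u) = lambda a *: id_tensor lambda u.
Proof.
rewrite /id_tensor scaler_sumr; apply: eq_bigr => i _.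
rewrite /ps_tensor scalerA -rmorphM; congr (lambda _ *: _).
apply: psP => n; rewrite pscoefM [pscoef _ n]/= linear_sum.
by apply: eq_bigr => k _; rewrite linearZ.
Qed.

(** The partial sum up to N agrees with the limit in all degrees below N, so the
difference is divisible by T^N. *)
Lemma cvg_id_tensor (M : vectType F) (u : mpowser M) :
  (fun n => \sum_(0 <= k < n) ps_tensor (pscoef u k) (lambda 'T ^+ k)) @ \oo
    --> id_tensor lambda u.
Proof.
move=> A [n _ nA]; exists n => // N /= nN; apply: nA.
set v := \sum_(_ <= _ < _) _.
pose w : mpowser M := v - id_tensor lambda u.
exists (PowSer (fun k => pscoef w (n + k)) : mpowser M) => //.
rewrite -(@ps_divXn F M n w) => [|k kn]; first by rewrite addrC subrK.
have kN := leq_trans kn nN.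
rewrite pscoefD [pscoef (- _) k]/= (pscoef_id_tensor _ kN).
rewrite /v big_mkord pscoef_sum -sumrB big1 // => i _.
by rewrite pscoef_tensor subrr.
Qed.

End Substitution.

Lemma id_tensorK (F : fieldType) (lambda mu : {lrmorphism powser F -> powser F})
    (M : vectType F) : cancel lambda mu ->
  cancel (@id_tensor F M lambda) (@id_tensor F M mu).
Proof.
move=> lambdaK u; rewrite -[RHS]id_tensor_id [id_tensor lambda u]/id_tensor.
have id_tensor_sum (v : 'I_(\dim {:M}) -> mpowser M) :
    id_tensor mu (\sum_i v i) = \sum_i id_tensor mu (v i).
  apply: (big_morph _ (@id_tensorD _ mu M)).
  apply: psP => n; rewrite (pscoef_id_tensor _ _ (ltnSn n)).
  by rewrite big1 // => k _; rewrite scaler0.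
rewrite id_tensor_sum.
by apply: eq_bigr => i _; rewrite id_tensorE; congr ps_tensor; exact: lambdaK.
Qed.

(** * Power series in two variables *)

(** Summing over a square is summing over antidiagonals, the corner beyond the
main antidiagonal being zero. *)
Lemma sum_triangle (V : nmodType) N (G : nat -> nat -> V) :
  (forall k l, (N <= k + l)%N -> G k l = 0) ->
  \sum_(k < N) \sum_(l < N) G k l = \sum_(n < N) \sum_(l < n.+1) G (n - l)%N l.
Proof.
move=> G0; rewrite exchange_big /=.
transitivity (\sum_(l < N) \sum_(n < N | (l <= n)%N) G (n - l)%N l); last first.
  rewrite (exchange_big_dep predT) //=; apply: eq_bigr => n _.
  rewrite (big_ord_widen _ (fun l => G (n - l)%N l) (ltn_ord n)).
  by apply: eq_bigl => l; rewrite ltnS.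
apply: eq_bigr => l _.
rewrite -(big_mkord predT (fun k => G k l)).
rewrite -(big_mkord (fun n => (l <= n)%N) (fun n => G (n - l)%N l)).
rewrite (@big_cat_nat _ _ _ (N - l)%N) ?leq_subr //=.
rewrite [X in _ + X]big_nat_cond [X in _ + X]big1 ?addr0; last first.
  by move=> k /andP[/andP[Nk _] _]; rewrite G0 // addnC -leq_subLR.
rewrite (@big_cat_nat _ _ _ l 0%N N) ?(ltnW (ltn_ord l)) //=.
rewrite [in RHS]big_nat_cond [X in _ = X + _]big1 ?add0r; last first.
  by move=> k /andP[/andP[_ kl]] /=; rewrite leqNgt kl.
have := @big_addn _ 0 +%R 0 N l (fun n => (l <= n)%N) (fun n => G (n - l)%N l).
rewrite add0n => ->; rewrite [RHS]big_mkcond /=.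
by apply: eq_bigr => n _; rewrite leq_addl addnK.
Qed.

(** The product of the two lowest coefficients is the lowest coefficient of the
product.  The hypothesis has the form of the conclusion, so that the lemma can be
iterated to reach F[[T,U]]. *)
Lemma ps_domain (R : comNzRingType) :
  (forall x y : R, x * y = 0 -> x = 0 \/ y = 0) ->
  forall f g : powser R, f * g = 0 -> f = 0 \/ g = 0.
Proof.
move=> domR f g fg0; apply: contrapT => /not_orP[f0 g0].
have least (h : powser R) : h <> 0 ->
    exists2 n, pscoef h n <> 0 & forall k, (k < n)%N -> pscoef h k = 0.
  move=> h0; have ex_n : exists n, pscoef h n != 0.
    apply: contrapT => all0; apply: h0; apply: psP => n.
    by apply: contrapT => hn; apply: all0; exists n; apply/eqP.
  case: (ex_minnP ex_n) => n /eqP hn minn; exists n => // k kn.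
  by apply/eqP; apply: contraTT kn => /minn; rewrite -leqNgt.
have [m fm fm0] := least f f0; have [n gn gn0] := least g g0.
have := congr1 (@pscoef R ^~ (m + n)%N) fg0; rewrite pscoefM.
have mmn : (m < (m + n).+1)%N by rewrite ltnS leq_addr.
rewrite (bigD1 (Ordinal mmn)) //= big1 => [|i]; last first.
  rewrite -val_eqE /= neq_ltn => /orP[im|mi]; first by rewrite fm0 ?mul0r.
  by rewrite [X in _ * X]gn0 ?mulr0 // ltn_subLR ?leq_ord // ltn_add2r.
by rewrite addr0 addKn => /domR[].
Qed.

Lemma pscoefMn (V : zmodType) (a : powser V) c n :
  pscoef (a *+ c) n = pscoef a n *+ c.
Proof. by elim: c => [|c IHc]; rewrite ?mulr0n // !mulrS pscoefD IHc. Qed.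

Lemma psCX (R : comNzRingType) (a : R) n : psC a ^+ n = psC (a ^+ n).
Proof.
elim: n => [|n IHn] //; rewrite !exprS IHn; apply: psP => k.
rewrite (@psconvC _ R^o (psC a)) /=.
by case: (k == 0)%N; rewrite ?scale0r.
Qed.

Section BivariateSeries.
Variable R : comNzRingType.
Implicit Types f g : powser (powser R).

(** F[[T,U]] is encoded as series in T over F[[U]]: in [pscoef (pscoef f j) i]
the exponent of T is j and that of U is i. *)
Definition total_order_ge N f :=
  forall j i, (j + i < N)%N -> pscoef (pscoef f j) i = 0.

Lemma pscoef2M f g j i : pscoef (pscoef (f * g) j) i =
  \sum_(a < j.+1) \sum_(b < i.+1)
    pscoef (pscoef f a) b * pscoef (pscoef g (j - a)) (i - b).
Proof. by rewrite pscoefM pscoef_sum. Qed.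

Lemma total_order_geM M N f g :
  total_order_ge M f -> total_order_ge N g -> total_order_ge (M + N) (f * g).
Proof.
move=> fM gN j i jiMN; rewrite pscoef2M; apply: big1 => a _; apply: big1 => b _.
have [abM|Mab] := ltnP (a + b) M; first by rewrite fM ?mul0r.
have aj := leq_ord a; have bi := leq_ord b.
rewrite gN ?mulr0 // -(ltn_add2l (a + b)) addnACA !subnKC //.
by rewrite (leq_trans jiMN) // leq_add2r.
Qed.

Lemma total_order_geD N f g :
  total_order_ge N f -> total_order_ge N g -> total_order_ge N (f + g).
Proof. by move=> fN gN j i jiN; rewrite !pscoefD fN // gN // addr0. Qed.

Lemma total_order_geX n f : total_order_ge 1 f -> total_order_ge n (f ^+ n).
Proof.
move=> f1; elim: n => [|n IHn]; first by move=> j i.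
by rewrite exprS -add1n; exact: total_order_geM.
Qed.

Lemma total_order_ge_le M N f :
  (M <= N)%N -> total_order_ge N f -> total_order_ge M f.
Proof. by move=> MN fN j i jiM; rewrite fN // (leq_trans jiM). Qed.

Lemma total_order_geC N (a : powser R) :
  (forall i, (i < N)%N -> pscoef a i = 0) -> total_order_ge N (psC a).
Proof. by move=> aN [|j] i // jiN; rewrite [LHS]aN. Qed.

(** The series a(T + U). *)
Definition ps_shift (a : powser R) : powser (powser R) :=
  PowSer (fun j => PowSer (fun i => pscoef a (i + j)%N *+ 'C(i + j, i))).

(** Substituting T + U is multiplicative by the Vandermonde identity: collecting
the terms a_n b_(i+j-n) on the right-hand side, the coefficient is
sum_l 'C(n, l) 'C(i+j-n, i-l). *)
Lemma ps_shiftM a b : ps_shift (a * b) = ps_shift a * ps_shift b.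
Proof.
apply: psP => j; apply: psP => i; rewrite pscoef2M.
(* The cut-offs k <= j and l <= i are needed since natural number subtraction is
   truncated, which would produce spurious terms in the larger square. *)
pose G (k l : nat) : R := if (k <= j)%N && (l <= i)%N then
  pscoef (pscoef (ps_shift a) k) l *
    pscoef (pscoef (ps_shift b) (j - k)) (i - l) else 0.
transitivity (\sum_(k < (i + j).+1) \sum_(l < (i + j).+1) G k l); last first.
  have le_j : (j < (i + j).+1)%N by rewrite ltnS leq_addl.
  have le_i : (i < (i + j).+1)%N by rewrite ltnS leq_addr.
  rewrite [RHS](big_ord_widen _ (fun k => \sum_(l < i.+1)
    pscoef (pscoef (ps_shift a) k) l *
    pscoef (pscoef (ps_shift b) (j - k)) (i - l)) le_j) [RHS]big_mkcond.
  apply: eq_bigr => k _; rewrite ltnS /G.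
  case: (_ <= j)%N; last by rewrite big1.
  rewrite (big_ord_widen _ (fun l => pscoef (pscoef (ps_shift a) k) l *
    pscoef (pscoef (ps_shift b) (j - k)) (i - l)) le_i) [RHS]big_mkcond.
  by apply: eq_bigr => l _; rewrite ltnS.
rewrite sum_triangle => [|k l ijkl]; last first.
  rewrite /G; case: ifP => // /andP[kj li].
  by rewrite leqNgt ltnS addnC leq_add in ijkl.
rewrite [LHS](_ : _ = pscoef (a * b) (i + j) *+ 'C(i + j, i)) // pscoefM.
rewrite -sumrMnl; apply: eq_bigr => n _.
have nij : (n <= i + j)%N by exact: leq_ord.
have -> : 'C(i + j, i) = (\sum_(l < i.+1) 'C(n, l) * 'C(i + j - n, i - l))%N.
  by rewrite binomial.Vandermonde subnKC.
rewrite -sumrMnr.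
rewrite (big_ord_widen (i + j).+1 (fun l => pscoef a n * pscoef b (i + j - n)
  *+ ('C(n, l) * 'C(i + j - n, i - l)))) ?ltnS ?leq_addr // big_mkcond.
rewrite [RHS](big_ord_widen (i + j).+1 (fun l => G (n - l)%N l)) ?ltnS //.
rewrite [RHS]big_mkcond; apply: eq_bigr => l _; rewrite !ltnS /G.
have [li|il] := leqP l i; last by rewrite andbF if_same.
rewrite andbT; have [ln|nl] := leqP l n; last by rewrite bin_small // mul0n.
have [nlj|jnl] := leqP (n - l) j.
  have -> : (i + j - n = i - l + (j - (n - l)))%N by lia.
  by rewrite /= subnKC // mulrnAl mulrnAr -mulrnA mulnC.
by rewrite [X in (_ * X)%N]bin_small ?muln0 //; lia.
Qed.

Lemma ps_shiftX a n : ps_shift (a ^+ n) = ps_shift a ^+ n.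
Proof.
elim: n => [|n IHn]; last by rewrite !exprS ps_shiftM IHn.
by apply: psP => -[|j]; apply: psP => -[|i]; rewrite //= ?addnS ?mul0rn.
Qed.

End BivariateSeries.

Lemma map_powserX (R S : comNzRingType) (h : {rmorphism R -> S})
    (a : powser R) n :
  PowSer (h \o pscoef (a ^+ n)) = PowSer (h \o pscoef a) ^+ n.
Proof.
elim: n => [|n IHn].
  by apply: psP => -[|j]; rewrite /= ?rmorph1 ?rmorph0.
rewrite !exprS -IHn; apply: psP => j; rewrite pscoefM /= rmorph_sum.
by apply: eq_bigr => i _; rewrite rmorphM.
Qed.

(** If the middle binomial coefficients of exponent q vanish, then the q-th power
is additive, as for the Frobenius map; in a domain it is then injective. *)
Lemma exprn_inj_bin (R : comNzRingType) q (a b : R) :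
  (forall x y : R, x * y = 0 -> x = 0 \/ y = 0) -> (0 < q)%N ->
  (forall i (x : R), (0 < i < q)%N -> x *+ 'C(q, i) = 0) ->
  a ^+ q = b ^+ q -> a = b.
Proof.
move=> domR q0 binq abq.
have : (b - a) ^+ q = 0.
  have := exprDn a (b - a) q; rewrite addrC subrK -abq.
  case: q q0 binq {abq} => // q' _ binq; rewrite big_ord_recl big_ord_recr /=.
  rewrite big1 => [|i _]; last by rewrite binq //= /bump add1n !ltnS ltn_ord.
  rewrite add0r bin0 subn0 expr0 mulr1 mulr1n /= /bump add1n subnn binn.
  by rewrite mul1r mulr1n -[X in X = _]addr0 => /addrI.
move=> ba0; apply/esym/subr0_eq; move: ba0; move: (b - a) => x {binq abq q0}.
elim: q => [/eqP|q IHq]; first by rewrite expr0 oner_eq0.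
by rewrite exprS => /domR[].
Qed.

(** The quotient of f^(qc) - g^(qc) by f^q - g^q is a form of degree c - 1 in f^q
and g^q, so it has no constant term once c >= 2. *)
Lemma total_order_ge_subXX (R : comNzRingType) (f g : powser (powser R)) q c N :
  (0 < q)%N -> total_order_ge 1 f -> total_order_ge 1 g ->
  total_order_ge N (f ^+ q - g ^+ q) ->
  total_order_ge N.+1 (f ^+ (q * c.+2) - g ^+ (q * c.+2)).
Proof.
move=> q0 f1 g1 fgN; rewrite !exprM subrXX -addn1.
apply: total_order_geM => //.
have q1 h : total_order_ge 1 h -> total_order_ge 1 (h ^+ q).
  by move=> h1; apply: (total_order_ge_le q0); exact: total_order_geX.
apply: (big_ind (total_order_ge 1)) => [//||k _]; first exact: total_order_geD.
apply: (@total_order_ge_le _ _ (c.+1 - k + k)).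
  by rewrite subnK ?leq_ord.
by apply: total_order_geM; apply: total_order_geX; exact: q1.
Qed.

(** * The lowest term of an iterative derivation *)

(** Let q > 0 be least with theta^(q) <> 0.  Then theta^(i) theta^(q-i) vanishes
for 0 < i < q, and it is 'C(q, i) theta^(q): the middle binomial coefficients are
zero in F, that is, q is 1 or a power of the characteristic.  If n = q a + b with
0 < b < q, then theta^(b) theta^(q a) also vanishes, and it is theta^(n) because
'C(n, b) = 1 in F. *)
Lemma iterder_order (F : fieldType) (theta : iterder F) :
  ~ iterder_trivial theta ->
  exists q r, [/\ (0 < q)%N, pscoef (theta r) q <> 0,
    forall i, (0 < i < q)%N -> 'C(q, i)%:R = 0 :> F &
    forall n s, ~~ (q %| n)%N -> pscoef (theta s) n = 0].
Proof.
move=> nontriv.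
pose nonzero n := `[< (0 < n)%N /\ exists r, pscoef (theta r) n <> 0 >].
have ex_n : exists n, nonzero n.
  apply: contrapT => all0; apply: nontriv => r; apply: psP => -[|n].
    exact: iterder0.
  apply: contrapT => rn; apply: all0; exists n.+1; apply/asboolP.
  by split=> //; exists r.
case: (ex_minnP ex_n) => q /asboolP[q0 [r rq]] minq.
have theta0 n s : (0 < n < q)%N -> pscoef (theta s) n = 0.
  move=> /andP[n0 nq]; apply: contrapT => sn.
  suff /minq : nonzero n by rewrite leqNgt nq.
  by apply/asboolP; split=> //; exists s.
have binq i : (0 < i < q)%N -> 'C(q, i)%:R = 0 :> F.
  move=> /andP[i0 iq]; have := iterder_iter theta i (q - i) r.
  rewrite subnKC ?(ltnW iq) // (theta0 (q - i)%N) ?rmorph0; last by lia.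
  rewrite -[_ *+ _ in RHS]mulr_natr [pscoef 0 _]/= => /esym/eqP.
  by rewrite mulf_eq0 => /orP[/eqP//|/eqP].
(* Peel off one q at a time: in the Vandermonde sum for q + (q * a + b) only the
   term choosing nothing from q survives. *)
have binqM a b : (b < q)%N -> 'C(q * a + b, b)%:R = 1 :> F.
  move=> bq; elim: a => [|a IHa]; first by rewrite muln0 add0n binn.
  rewrite mulnS -addnA -binomial.Vandermonde natr_sum big_ord_recl.
  rewrite bin0 mul1n subn0 IHa big1 ?addr0 // => i _.
  rewrite natrM binq ?mul0r //= (leq_ltn_trans _ bq) //; exact: (ltn_ord i).
exists q, r; split=> // n s; rewrite /dvdn -lt0n => nq.
have := iterder_iter theta (n %% q)%N (q * (n %/ q)) s.
have nE : (n %% q + q * (n %/ q) = n)%N by rewrite addnC mulnC -divn_eq.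
have nqq : (n %% q < q)%N by rewrite ltn_mod.
have := binqM (n %/ q)%N _ nqq; rewrite addnC nE => C1.
by rewrite theta0 ?nq ?nqq // -[_ *+ _ in RHS]mulr_natr C1 mulr1.
Qed.

(** * Iterating a twist *)

Section IteratedTwist.
Variables (F : fieldType) (theta theta' : iterder F).
Variable lambda : {lrmorphism powser F -> powser F}.
Hypothesis lambda_theta : theta' =1 lambda \o theta.
Local Notation P := (lambda 'T).

(** The series A = P(U) + theta'_U(P)(T), which takes the place of the parameter
when a twist is applied twice. *)
Definition iter_twist_param : powser (powser F) :=
  PowSer (theta' \o pscoef P) + psC P.

Lemma iter_twist_param_order : total_order_ge 1 iter_twist_param.
Proof.
apply: total_order_geD => -[|j] [|i] //= _; last exact: ps_lrmorphT0.
by rewrite ps_lrmorphT0 rmorph0.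
Qed.

Lemma ps_shift_order : total_order_ge 1 (ps_shift P).
Proof. by case=> [|j] [|i] //= _; rewrite ps_lrmorphT0 mul0rn. Qed.

Section Module.
Variables (M : vectType F) (thetaM : M -> mpowser M).
Hypothesis idM : is_idmodule theta thetaM.
Local Notation thetaM' := (twist lambda thetaM).

Lemma twistD : {morph thetaM' : x y / x + y}.
Proof. by move=> x y; rewrite /twist /= (idmoduleD idM) id_tensorD. Qed.

Lemma twistZ r m : thetaM' (r *: m) = theta' r *: thetaM' m.
Proof. by rewrite /twist /= (idmoduleZ idM) id_tensorZ lambda_theta. Qed.

Lemma twist0 : thetaM' 0 = 0.
Proof. by rewrite -[X in thetaM' X](scale0r 0) twistZ rmorph0 scale0r. Qed.

Lemma twist_pscoef0 m : pscoef (thetaM' m) 0 = m.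
Proof.
rewrite (pscoef_id_tensor _ _ (ltnSn 0)) big_ord1 expr0 scale1r.
exact: idmodule0 idM m.
Qed.

Lemma iter_twist_paramX n j i :
  pscoef (pscoef (iter_twist_param ^+ n) j) i = \sum_(l < n.+1)
    pscoef (pscoef (PowSer (theta' \o pscoef P) ^+ (n - l) * psC (P ^+ l)) j) i
      *+ 'C(n, l).
Proof.
rewrite exprDn !pscoef_sum; apply: eq_bigr => l _.
by rewrite psCX !pscoefMn.
Qed.

(** Expanding both twists gives
sum_(k,l) theta'_U(P^k) P(U)^l theta_M^(l)(theta_M^(k)(m)); iterativity of theta_M
turns the composite into 'C(k+l, l) theta_M^(k+l)(m), and the terms with
k + l = n add up to A^n by the binomial theorem. *)
Lemma pscoef_twist_twist N i j m : (j + i < N)%N ->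
  pscoef (thetaM' (pscoef (thetaM' m) j)) i =
  \sum_(n < N) pscoef (pscoef (iter_twist_param ^+ n) j) i *: pscoef (thetaM m) n.
Proof.
move=> jiN; set L := PowSer (theta' \o pscoef P).
pose W k l := pscoef (pscoef (L ^+ k * psC (P ^+ l)) j) i.
pose G k l := W k l *: (pscoef (thetaM m) (k + l)%N *+ 'C(k + l, l)).
have W0 k l : (N <= k + l)%N -> W k l = 0.
  move=> Nkl; rewrite /W.
  have := @total_order_geM _ k l (L ^+ k) (psC (P ^+ l)); apply.
  - apply: total_order_geX => -[|?] [|?] //= _.
    by rewrite ps_lrmorphT0 rmorph0.
  - by apply: total_order_geC => ? ?; exact: pscoef_lrmorphTX.
  - exact: leq_trans Nkl.
transitivity (\sum_(k < N) \sum_(l < N) G k l); last first.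
  rewrite sum_triangle => [|k l Nkl]; last by rewrite /G W0 ?scale0r.
  apply: eq_bigr => n _; rewrite iter_twist_paramX scaler_suml.
  apply: eq_bigr => l _; rewrite /G subnK ?leq_ord //.
  by rewrite -scalerMnl scalerMnr.
rewrite (pscoef_id_tensor _ _ (leq_ltn_trans (leq_addr i j) jiN)).
rewrite (big_morph _ twistD twist0) pscoef_sum; apply: eq_bigr => k _.
rewrite twistZ pscoef_conv.
transitivity (\sum_(a < i.+1) \sum_(l < N) pscoef (theta' (pscoef (P ^+ k) j)) a
   *: (pscoef (P ^+ l) (i - a) *: (pscoef (thetaM m) (k + l)%N *+ 'C(k + l, l)))).
  apply: eq_bigr => a _; rewrite (pscoef_id_tensor _ _ (N := N)); last by lia.
  rewrite scaler_sumr; apply: eq_bigr => l _.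
  by rewrite (idmodule_iter idM) addnC.
rewrite exchange_big; apply: eq_bigr => l _ /=; rewrite /G /W /L -map_powserX.
have -> : pscoef (PowSer (theta' \o pscoef (P ^+ k)) * psC (P ^+ l)) j =
   theta' (pscoef (P ^+ k) j) * P ^+ l.
  exact: (@psconvC _ (powser F)^o).
rewrite pscoefM scaler_suml; apply: eq_bigr => a _.
by rewrite scalerA.
Qed.

(** The left-hand side is the right-hand side of the iterativity axiom for the
twist. *)
Lemma pscoef_twist_shift N i j m : (j + i < N)%N ->
  pscoef (thetaM' m) (i + j)%N *+ 'C(i + j, i) =
  \sum_(n < N) pscoef (pscoef (ps_shift P ^+ n) j) i *: pscoef (thetaM m) n.
Proof.
rewrite addnC => ijN; rewrite (pscoef_id_tensor _ _ ijN) -sumrMnl.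
by apply: eq_bigr => n _; rewrite -ps_shiftX scalerMnl.
Qed.

End Module.

Lemma is_idmodule_iterder (delta : iterder F) :
  @is_idmodule F delta F^o delta.
Proof.
split; [exact: rmorphD | exact: rmorphM | exact: iterder0 | exact: iterder_iter].
Qed.

Lemma twist_iterder r : twist lambda (theta : F^o -> mpowser F^o) r = theta' r.
Proof.
rewrite lambda_theta; apply: psP => n.
rewrite (pscoef_id_tensor _ _ (ltnSn n)) (pscoef_lrmorph _ _ (ltnSn n)).
by apply: eq_bigr => k _; exact: mulrC.
Qed.

(** The two expansions of the iterated twist, on the module F whose twist theta'
is known to be iterative. *)
Lemma iterder_subst_param_sub N i j r : (j + i < N)%N ->
  \sum_(n < N) (pscoef (pscoef (iter_twist_param ^+ n) j) i -
    pscoef (pscoef (ps_shift P ^+ n) j) i) * pscoef (theta r) n = 0.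
Proof.
move=> jiN; under eq_bigr do rewrite mulrBl; rewrite sumrB; apply/eqP.
have idF := is_idmodule_iterder theta.
rewrite subr_eq0 -[X in X == _](@pscoef_twist_twist F^o theta idF N i j r jiN).
rewrite -[X in _ == X](@pscoef_twist_shift F^o theta N i j r jiN) !twist_iterder.
by rewrite iterder_iter.
Qed.

(** Induction on the total degree: if D = A^q - B^q has order at least N, then in
total degree N the relation [iterder_subst_param_sub] reads theta^(q)(r) D = 0. *)
Lemma iter_twist_paramX_order q r N : (0 < q)%N -> pscoef (theta r) q <> 0 ->
  (forall n s, ~~ (q %| n)%N -> pscoef (theta s) n = 0) ->
  total_order_ge N (iter_twist_param ^+ q - ps_shift P ^+ q).
Proof.
move=> q0 rq thetaNq.
elim: N => [|N IHN] j i //; rewrite ltnS leq_eqVlt.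
case/orP=> [/eqP jiN|]; last exact: IHN.
have qN : (q < (N + q).+1)%N by rewrite ltnS leq_addl.
have := iterder_subst_param_sub (N := (N + q).+1) (i := i) (j := j) r.
rewrite ltnS jiN leq_addr.
move=> /(_ isT); rewrite (bigD1 (Ordinal qN)) //= big1 ?addr0 => [|n nq].
  by move=> /eqP; rewrite mulf_eq0 => /orP[/eqP //|/eqP].
have [/dvdnP[c nE]|/thetaNq ->] := boolP (q %| n)%N; last by rewrite mulr0.
(* Here n = q c; the terms with c > 1 vanish in total degree N. *)
rewrite -[X in X * _](_ : pscoef (pscoef
  (iter_twist_param ^+ n - ps_shift P ^+ n) j) i = _) //.
case: c nE => [|[|c]] nE; first by rewrite nE mul0n !expr0 subrr mul0r.
  by case/negP: nq; rewrite -val_eqE /= nE mul1n.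
have := total_order_ge_subXX c q0 iter_twist_param_order ps_shift_order IHN.
by rewrite mulnC -nE => -> //; rewrite ?mul0r // jiN.
Qed.

Lemma iter_twist_paramE :
  ~ iterder_trivial theta -> iter_twist_param = ps_shift P.
Proof.
move=> nontriv.
have [q [r [q0 rq binq thetaNq]]] := iterder_order nontriv.
have ABq := iter_twist_paramX_order q0 rq thetaNq.
have domF (x y : F) : x * y = 0 -> x = 0 \/ y = 0.
  by move=> /eqP; rewrite mulf_eq0 => /orP[] /eqP; [left | right].
apply: (exprn_inj_bin (ps_domain (ps_domain domF)) q0) => [i x iq|].
  apply: psP => j; apply: psP => k; rewrite !pscoefMn -[LHS]mulr_natr.
  by rewrite binq ?mulr0.
apply/subr0_eq; apply: psP => j; apply: psP => i.
exact: (ABq (j + i).+1).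
Qed.

Lemma is_idmodule_twist (M : vectType F) (thetaM : M -> mpowser M) :
  ~ iterder_trivial theta -> is_idmodule theta thetaM ->
  is_idmodule theta' (twist lambda thetaM).
Proof.
move=> nontriv idM; split; first exact: twistD idM.
- exact: twistZ.
- exact: twist_pscoef0.
move=> i j m; have jiN : (j + i < (j + i).+1)%N by [].
rewrite (pscoef_twist_twist idM _ jiN) (pscoef_twist_shift _ _ jiN).
by rewrite iter_twist_paramE.
Qed.

End IteratedTwist.

(** * The twist as an equivalence of categories *)

Lemma mpsmap_twist (F : fieldType) (theta : iterder F)
    (lambda : {lrmorphism powser F -> powser F}) (M N : idmodule theta)
    (f : 'Hom(M, N)) : is_idhom f ->
  mpsmap f \o twist lambda (idmodule_map M) =1
  twist lambda (idmodule_map N) \o f.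
Proof.
move=> idf m.
transitivity (id_tensor lambda (mpsmap f (idmodule_map M m))); last first.
  exact: (congr1 (@id_tensor F N lambda) (idf m)).
apply: psP => n; rewrite /= !(pscoef_id_tensor _ _ (ltnSn n)) linear_sum.
by apply: eq_bigr => k _; rewrite linearZ.
Qed.

Lemma bij_lrmorphism_inv (F : fieldType)
    (lambda : {lrmorphism powser F -> powser F}) : bijective lambda ->
  exists2 mu : {lrmorphism powser F -> powser F},
    cancel lambda mu & cancel mu lambda.
Proof.
case=> g lambdaK gK.
pose gL := GRing.isLinear.Build F (powser F) (powser F) *:%R g
  (can2_linear lambdaK gK).
pose gM := GRing.isMonoidMorphism.Build (powser F) (powser F) g
  (can2_monoid_morphism lambdaK gK).
pose mu : {lrmorphism powser F -> powser F} := HB.pack g gL gM.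
by exists mu.
Qed.

(** The composite of the two functors keeps the vector space and, by
[id_tensorK], the values of the iterative derivation, so that identity maps are
ID-homomorphisms in both directions. *)
Lemma twist_functorK (F : fieldType) (theta theta' : iterder F)
    (lambda mu : {lrmorphism powser F -> powser F})
    (ob : forall M : idmodule theta,
       is_idmodule theta' (twist lambda (idmodule_map M)))
    (hom : forall (M N : idmodule theta) (f : idhom M N),
       @is_idhom F theta' (twist_ob ob M) (twist_ob ob N) f)
    (ob' : forall M : idmodule theta',
       is_idmodule theta (twist mu (idmodule_map M)))
    (hom' : forall (M N : idmodule theta') (f : idhom M N),
       @is_idhom F theta (twist_ob ob' M) (twist_ob ob' N) f) :
  cancel lambda mu ->
  nat_iso (functor_comp (twist_functor hom') (twist_functor hom))
    (functor_id (IDMod theta)).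
Proof.
move=> lambdaK.
have twistK (M : idmodule theta) m :
    idmodule_map (twist_ob ob' (twist_ob ob M)) m = idmodule_map M m.
  exact: id_tensorK.
have to_M (M : idmodule theta) :
    @is_idhom F theta (twist_ob ob' (twist_ob ob M)) M \1%VF.
  move=> m; rewrite /= id_lfunE; apply: psP => n.
  by rewrite /= id_lfunE; congr (pscoef _ n); exact: twistK.
have of_M (M : idmodule theta) :
    @is_idhom F theta M (twist_ob ob' (twist_ob ob M)) \1%VF.
  move=> m; rewrite /= id_lfunE; apply: psP => n.
  by rewrite /= id_lfunE; congr (pscoef _ n); exact/esym/twistK.
exists (fun M => IDHom (to_M M)); split=> [M | M N f].
  by exists (IDHom (of_M M)); split; apply: idhom_inj; exact: comp_lfun1l.
apply: idhom_inj; transitivity (idhom_lfun f); first exact: comp_lfun1r.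
by apply/esym; exact: comp_lfun1l.
Qed.

Theorem theorem3p6 (F : fieldType) (theta theta' : iterder F)
    (theta_nontrivial : ~ iterder_trivial theta)
    (theta'_nontrivial : ~ iterder_trivial theta')
    (theta_equiv : iterder_equiv theta theta')
    (lambda : {lrmorphism powser F -> powser F})
    (lambda_iso : cont_alg_iso lambda)
    (lambda_theta : theta' =1 lambda \o theta) :
  (forall (M : vectType F) (thetaM : M -> mpowser M),
     is_idmodule theta thetaM ->
     is_idmodule theta' (twist lambda thetaM) /\
     forall m : M,
       (fun n => \sum_(0 <= k < n)
          ps_tensor (pscoef (thetaM m) k) (lambda 'T ^+ k)) @ \oo
         --> twist lambda thetaM m) /\
  (exists (twist_ob_axiom : forall M : idmodule theta,
             is_idmodule theta' (twist lambda (idmodule_map M)))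
          (twist_hom_axiom : forall (M N : idmodule theta) (f : idhom M N),
             @is_idhom F theta' (twist_ob twist_ob_axiom M)
               (twist_ob twist_ob_axiom N) f),
     cat_equivalence (twist_functor twist_hom_axiom)).
Proof.
case: lambda_iso => /bij_lrmorphism_inv[mu lambdaK muK] _.
have mu_theta' : theta =1 mu \o theta'.
  by move=> r; rewrite /= lambda_theta lambdaK.
split.
  move=> M thetaM idM; split; first exact: (is_idmodule_twist lambda_theta).
  by move=> m; exact: cvg_id_tensor.
have ob M := is_idmodule_twist lambda_theta theta_nontrivial
  (@idmodule_axiom _ theta M).
have ob' M := is_idmodule_twist mu_theta' theta'_nontrivial
  (@idmodule_axiom _ theta' M).
exists ob.
have hom (M N : idmodule theta) (f : idhom M N) :
    @is_idhom F theta' (twist_ob ob M) (twist_ob ob N) f.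
  exact: mpsmap_twist (idhom_axiom f).
have hom' (M N : idmodule theta') (f : idhom M N) :
    @is_idhom F theta (twist_ob ob' M) (twist_ob ob' N) f.
  exact: mpsmap_twist (idhom_axiom f).
exists hom; exists (twist_functor hom').
by split; exact: twist_functorK.
Qed.
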